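(* Consider the Gauss hypergeometric weight $w(k)=\frac{(a)_k(b)_k}{(c+1)_k}\frac{\eta^k}{k!}$, $k\in\mathbb N_0$, i.e. the case $\sigma(z)=\eta(z+a)(z+b)$, $\theta(z)=z(z+c)$ of the Pearson equation $\theta(k+1)w(k+1)=\sigma(k)w(k)$. Then, for all $n\in\mathbb N_0$, $$p^1_{n+1}=(n+2)\beta_{n+2}+\beta_{n+1}+\frac{\eta-1}{\eta+1}\Big(\gamma_{n+3}+\gamma_{n+2}+\beta_{n+2}^2+\frac{(n+2)(n+1)}{2}\Big)+\frac{1}{\eta+1}\Big(\eta ab+(\eta(a+b)-c)\beta_{n+2}+(\eta(a+b)+c)(n+2)\Big),$$ $$\pi^{[2]}_n=\frac{1}{1+\eta}\Big((n+2)(n+1)-\eta ab-(\eta(a+b)-c)\beta_{n+2}-(\eta(a+b)+c)(n+2)\Big)+\frac{1-\eta}{1+\eta}\big(\gamma_{n+3}+\gamma_{n+2}+\beta_{n+2}^2\big)-(n+2)(\beta_{n+2}+\beta_{n+1}).$$ Moreover, the Laguerre--Freud structure matrix $\Psi=(\Psi_{n,m})_{n,m\in\mathbb N_0}$ is the pentadiagonal matrix with entries, for all $n\in\mathbb N_0$, $$\Psi_{n+2,n}=\eta H_{n+2},\qquad \Psi_{n+1,n}=\eta(\beta_n+\beta_{n+1}+a+b+n)H_{n+1},$$ $$\Psi_{n,n}=\eta\Big(\gamma_n+\gamma_{n+1}+(\beta_n+a)(\beta_n+b)+n(\beta_{n-1}+\beta_n+a+b)+\pi^{[2]}_{n-2}\Big)H_n,$$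 $$\Psi_{n,n+1}=(\beta_n+\beta_{n+1}+c-n)H_{n+1},\qquad \Psi_{n,n+2}=H_{n+2},$$ and all other entries zero, where $\gamma_0=0$, $\beta_{-1}=0$ and $\pi^{[2]}_{-2}=\pi^{[2]}_{-1}=0$.
   Context: $\mathbb N_0=\{0,1,2,\dots\}$; $(x)_k=x(x+1)\cdots(x+k-1)$. The parameters $a,b,c,\eta$ are real, $\eta\notin\{0,-1\}$, $c+1\notin\{0,-1,-2,\dots\}$, such that all moments $\rho_n=\sum_{k\ge0}k^nw(k)$ converge absolutely and all Hankel determinants $\det(\rho_{i+j})_{i,j=0}^{k-1}$, $k\ge1$, are nonzero. Then there are monic orthogonal polynomials $P_n(z)=z^n+p^1_nz^{n-1}+\cdots$ (with $p^1_0=0$), satisfying $\sum_{k\ge0}P_n(k)P_m(k)w(k)=\delta_{n,m}H_n$, $H_n\ne0$, and $zP_n(z)=P_{n+1}(z)+\beta_nP_n(z)+\gamma_nP_{n-1}(z)$, $P_{-1}=0$, with $\gamma_{n+1}=H_{n+1}/H_n$. Rows and columns of semi-infinite matrices are indexed by $\mathbb N_0$. $J$ is the tridiagonal Jacobi matrix with $J_{n,n}=\beta_n$, $J_{n,n+1}=1$, $J_{n+1,n}=\gamma_{n+1}$; $H=\operatorname{diag}(H_0,H_1,\dots)$; $P(z)=(P_0(z),P_1(z),\dots)^\top$. The dressed Pascal matrix $\Pi$ is the lower unitriangular semi-infinite matrix determined by $P(z+1)=\Pi P(z)$, and $\pi^{[2]}_n:=\Pi_{n+2,n}$, $n\in\mathbb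 N_0$, are the entries of its second subdiagonal. For a weight satisfying $\theta(k+1)w(k+1)=\sigma(k)w(k)$, $k\in\mathbb N_0$, with polynomials $\theta,\sigma$, $\theta(0)=0$, the Laguerre--Freud structure matrix is $\Psi:=\Pi^{-1}H\theta(J^\top)$, which also equals $\sigma(J)H\Pi^\top$. *)

(* Defs.v *)
From mathcomp Require Import all_boot all_order all_algebra.
From mathcomp Require Import ring.
From mathcomp Require Import all_classical all_reals all_analysis.
Set Implicit Arguments.
Unset Strict Implicit.
Unset Printing Implicit Defensive.
Import Order.TTheory GRing.Theory Num.Theory.
Import numFieldNormedType.Exports.
Local Open Scope classical_set_scope.
Local Open Scope ring_scope.

(* [lag j u] is n |-> u_(n - j), with the convention that terms of negative
   index are 0: [lag 1 P n] is P_{n-1} with P_{-1} = 0. *)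
Definition lag (V : nmodType) (j : nat) (u : nat -> V) (n : nat) : V :=
  if (n < j)%N then 0 else u (n - j)%N.

Section SemiInfinite.
Variable R : nzRingType.

(* Semi-infinite matrices, rows and columns indexed by nat. *)
Definition smx := nat -> nat -> R.

Implicit Types (A B : smx) (v : nat -> R).

(* Finite-support sums: each product taken below involves only finitely many
   nonzero terms per entry, its factors being banded or triangular. *)
Definition smul A B : smx := fun i j => \sum_(k \in [set: nat]) A i k * B k j.
Definition smulv A v : nat -> R := fun i => \sum_(k \in [set: nat]) A i k * v k.

Definition sone : smx := fun i j => (i == j)%:R.
Definition sdiag v : smx := fun i j => if i == j then v i else 0.
Definition str A : smx := fun i j => A j i.

Definition spow A (d : nat) : smx := iter d (smul A) sone.
Definition spoly (p : {poly R}) A : smx :=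
  fun i j => \sum_(d < size p) p`_d * spow A d i j.

Definition lower_unitri A : Prop :=
  (forall i, A i i = 1) /\ (forall i j, (i < j)%N -> A i j = 0).

(* Inverse in the group of lower unitriangular semi-infinite matrices. *)
Definition unitri_inverse A B : Prop :=
  [/\ lower_unitri B, smul A B = sone & smul B A = sone].

Definition jacobi (beta gamma : nat -> R) : smx := fun i j =>
  if j == i then beta i
  else if j == i.+1 then 1
  else if i == j.+1 then gamma i
  else 0.

End SemiInfinite.

Section Orthogonality.
Variable R : realType.
Implicit Types (w h beta gamma : nat -> R) (P : nat -> {poly R}) (Pi : smx R).

Definition moments_abs_cvg w : Prop :=
  forall n : nat, cvgn [normed series (fun k : nat => k%:R ^+ n * w k)].

Definition moment w (n : nat) : R :=
  limn (series (fun k : nat => k%:R ^+ n * w k)).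

Definition hankel w (k : nat) : 'M[R]_k :=
  \matrix_(i < k, j < k) moment w (i + j).

Record monic_orthogonal w P h beta gamma : Prop := MonicOrthogonal {
  mo_monic : forall n, P n \is monic;
  mo_size : forall n, size (P n) = n.+1;
  mo_orth : forall n m,
    series (fun k : nat => (P n).[k%:R] * (P m).[k%:R] * w k) @ \oo -->
      (if n == m then h n else 0);
  mo_norm_neq0 : forall n, h n != 0;
  mo_rec : forall n,
    'X * P n = P n.+1 + beta n *: P n + gamma n *: lag 1 P n;
  (* gamma_0 multiplies P_{-1} = 0, so it has to be fixed by convention. *)
  mo_gamma0 : gamma 0%N = 0;
  mo_gammaS : forall n, gamma n.+1 = h n.+1 / h n
}.

(* Coefficient of z^(n-1) in P_n, with value 0 at n = 0. *)
Definition p1 P (n : nat) : R := if n is m.+1 then (P n)`_m else 0.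

Definition dressed_pascal P Pi : Prop :=
  lower_unitri Pi /\
  forall z : R, (fun n => (P n).[z + 1]) = smulv Pi (fun n => (P n).[z]).

Definition pi2 Pi (n : nat) : R := Pi n.+2 n.

(* [Pinv] stands for the inverse of the dressed Pascal matrix. *)
Definition laguerre_freud (theta : {poly R}) (Pinv : smx R) h beta gamma
    : smx R :=
  smul Pinv (smul (sdiag h) (spoly theta (str (jacobi beta gamma)))).

End Orthogonality.

Section Gauss.
Variable R : realType.
Implicit Types a b c eta : R.

Definition pochhammer (x : R) (k : nat) : R := \prod_(0 <= i < k) (x + i%:R).

Definition gauss_weight a b c eta (k : nat) : R :=
  pochhammer a k * pochhammer b k / pochhammer (c + 1) k
  * (eta ^+ k / k`!%:R).

Definition gauss_sigma a b eta : {poly R} :=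
  eta *: (('X + a%:P) * ('X + b%:P)).
Definition gauss_theta c : {poly R} := 'X * ('X + c%:P).

Lemma gauss_pearson a b c eta (k : nat) :
  (forall i : nat, c + 1 != - i%:R) ->
  (gauss_theta c).[k.+1%:R] * gauss_weight a b c eta k.+1 =
  (gauss_sigma a b eta).[k%:R] * gauss_weight a b c eta k.
Proof.
move=> hc.
have hci (i : nat) : c + 1 + i%:R != 0 by rewrite addr_eq0.
have hp : pochhammer (c + 1) k != 0 by rewrite /pochhammer big_mkord; apply/prodf_neq0.
have hf : (k`!%:R : R) != 0 by rewrite pnatr_eq0 -lt0n fact_gt0.
have hk : (k%:R + 1 : R) != 0 by rewrite natr1 pnatr_eq0.
have hck := hci k.
rewrite /gauss_theta /gauss_sigma /gauss_weight !hornerE.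
rewrite /pochhammer !big_nat_recr //= -!/(pochhammer _ _).
rewrite factS natrM -[k.+1%:R]natr1 exprS.
by field; rewrite hf hp hk hck.
Qed.

End Gauss.

(* Main.v *)
From HB Require Import structures.
Require Import Defs.
From mathcomp Require Import all_boot all_order all_algebra.
From mathcomp Require Import ring.
From mathcomp Require Import all_classical all_reals all_analysis.
Set Implicit Arguments.
Unset Strict Implicit.
Unset Printing Implicit Defensive.
Import Order.TTheory GRing.Theory Num.Theory.
Import numFieldNormedType.Exports.
Local Open Scope classical_set_scope.
Local Open Scope ring_scope.

(* Write [L p] for the sum of [p(k) w(k)]. Since [Pinv] expresses P(z - 1) in
   the basis P, the structure matrix has entries
     Psi_{n,m} = L(theta(z) P_n(z - 1) P_m(z)) = L(sigma(z) P_n(z) P_m(z + 1)),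
   the second equality being the Pearson equation after the shift z -> z + 1.
   Both theta and sigma are quadratic, so the first form gives the part of
   [Psi] on and above the diagonal and the second the part on and below it.
   Equating the two values of Psi_{n+2,n+2} determines [pi2], and comparing
   coefficients of z^n in P_{n+2}(z + 1) turns this into the value of [p1]. *)

(** * Finite sums and lower unitriangular matrices *)

Lemma fsbig_nat_ord (V : nmodType) (F : nat -> V) (N : nat) :
  (forall k, (N <= k)%N -> F k = 0) ->
  \sum_(k \in [set: nat]) F k = \sum_(k < N) F k.
Proof.
move=> F0; rewrite fsbig_ord; apply/esym/fsbig_widen => // k [_ /=].
by move/negP; rewrite -leqNgt => /F0.
Qed.

Section LowerTriangular.
Variable R : nzRingType.
Implicit Types A B : smx R.

Lemma smul_lower A B i j N : lower_unitri A -> (i < N)%N ->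
  smul A B i j = \sum_(k < N) A i k * B k j.
Proof.
move=> [_ A0] iN; apply: fsbig_nat_ord => k Nk.
by rewrite A0 ?mul0r// (leq_trans iN).
Qed.

Lemma smulv_lower A v i : lower_unitri A ->
  smulv A v i = \sum_(k < i.+1) A i k * v k.
Proof. by move=> [_ A0]; apply: fsbig_nat_ord => k ik; rewrite A0 ?mul0r. Qed.

(** In entry (n+1, n) of [A B = 1] only k = n and k = n+1 survive, since [B] is lower triangular and
    [A] truncates the sum; both have a unit diagonal factor. *)
Lemma unitri_inverse_sub1 A B n : lower_unitri A -> unitri_inverse A B ->
  B n.+1 n = - A n.+1 n.
Proof.
move=> lA [lB AB _]; have := congr1 (fun M => M n.+1 n) AB.
rewrite /sone gtn_eqF// (smul_lower _ _ lA (ltnSn _)) !big_ord_recr/= big1.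
  rewrite lA.1 lB.1 add0r mul1r mulr1 => /eqP.
  by rewrite addr_eq0 => /eqP->; rewrite opprK.
by move=> i _; rewrite lB.2 ?mulr0 ?ltn_ord.
Qed.

Lemma unitri_inverse_sub2 A B n : lower_unitri A -> unitri_inverse A B ->
  B n.+2 n = A n.+2 n.+1 * A n.+1 n - A n.+2 n.
Proof.
move=> lA iB; have [lB AB _] := iB; have := congr1 (fun M => M n.+2 n) AB.
rewrite /sone gtn_eqF// (smul_lower _ _ lA (ltnSn _)) !big_ord_recr/= big1.
  rewrite lA.1 lB.1 (unitri_inverse_sub1 _ lA iB) add0r mul1r mulr1 => /eqP.
  by rewrite addrC addr_eq0 => /eqP->; rewrite mulrN opprD opprK addrC.
by move=> i _; rewrite lB.2 ?mulr0 ?ltn_ord.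
Qed.

End LowerTriangular.

(** * Coefficients of a translated polynomial *)

Section Shift.
Variable R : comNzRingType.

Lemma coef_comp_XaddC1 (p : {poly R}) N i : (size p <= N)%N ->
  (p \Po ('X + 1))`_i = \sum_(j < N) p`_j *+ 'C(j, i).
Proof.
move=> pN; rewrite coef_comp_poly
  (big_ord_widen _ (fun j => p`_j * (('X + 1) ^+ j)`_i) pN).
rewrite big_mkcond; apply: eq_bigr => j _.
case: ltnP => [_|/leq_sizeP/(_ _ (leqnn _))->]; last by rewrite mul0rn.
rewrite exprD1n coef_sum -mulr_natr; congr (_ * _).
under eq_bigr do rewrite coefMn coefXn.
have [ij|ji] := ltnP i j.+1; last first.
  rewrite bin_small// big1// => k _.
  by rewrite gtn_eqF ?mul0rn// (leq_trans _ ji).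
rewrite (bigD1 (Ordinal ij))//= eqxx big1 ?addr0// => k.
by rewrite -val_eqE/= eq_sym => /negPf->; rewrite mul0rn.
Qed.

End Shift.

(** * The moment functional and the Pearson equation *)

Section Functional.
Variable R : realType.
Implicit Types (w : nat -> R) (p q : {poly R}).

(** Absolute convergence of the moments gives convergence for every polynomial by linearity. Having
    [L] as a linear form turns every later argument about series into algebra. *)
Lemma moment_functional w : moments_abs_cvg w ->
  exists L : {scalar {poly R}}, forall p,
    series (fun k : nat => p.[k%:R] * w k) @ \oo --> L p.
Proof.
move=> hw.
have cv p : cvgn (series (fun k : nat => p.[k%:R] * w k)).
  (* Expanding p in monomials reduces convergence to that of the moment series, closed under sums
     and scalar multiples. *)
  have -> : (fun k : nat => p.[k%:R] * w k) =
      \sum_(i < size p) p`_i *: (fun k : nat => k%:R ^+ i * w k).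
    apply/funext => k; rewrite fct_sumE horner_coef mulr_suml.
    by apply: eq_bigr => i _; rewrite -mulrA.
  elim/big_ind: _ => [|f g cf cg|i _].
  - rewrite (_ : series 0 = cst 0); first exact: is_cvg_cst.
    by apply/funext => n; rewrite /series/= big1.
  - exact: is_cvg_seriesD.
  - by apply: is_cvg_seriesZ; exact: normed_cvg.
pose L0 p : R := limn (series (fun k : nat => p.[k%:R] * w k)).
have linL : scalar L0.
  move=> a p q; rewrite /L0 -[a * _]lim_seriesZ// -lim_seriesD//; last first.
    exact: is_cvg_seriesZ.
  congr (limn (series _)); apply/funext => k /=.
  by rewrite hornerD hornerZ mulrDl -mulrA.
by exists (HB.pack_for {scalar {poly R}} L0
  (GRing.isLinear.Build _ _ _ _ L0 linL)).
Qed.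

(* Summation by the shift [k -> k+1]: the term at [k = 0] vanishes. *)
Lemma pearson_shift w theta sigma (L : {scalar {poly R}}) q :
  (forall p, series (fun k : nat => p.[k%:R] * w k) @ \oo --> L p) ->
  theta.[0] = 0 ->
  (forall k : nat, theta.[k.+1%:R] * w k.+1 = sigma.[k%:R] * w k) ->
  L (theta * q) = L (sigma * (q \Po ('X + 1))).
Proof.
move=> hL th0 pe.
suff h : series (fun k : nat => (theta * q).[k%:R] * w k) @ \oo -->
    L (sigma * (q \Po ('X + 1))) by exact: cvg_unique (hL _) h.
rewrite -(cvg_shiftS (series _)).
rewrite (_ : [sequence _]_n = series (fun k : nat =>
  (sigma * (q \Po ('X + 1))).[k%:R] * w k)); first exact: hL.
apply/funext => n; rewrite /series/= big_nat_recl// hornerM th0 !mul0r add0r.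
apply: eq_bigr => k _; rewrite !hornerM horner_comp !hornerE natr1.
by rewrite mulrAC pe mulrAC.
Qed.

End Functional.

(** * Orthogonality and the Jacobi matrix *)

Section Orthogonal.
Variables (R : realType) (w H beta gamma : nat -> R) (P : nat -> {poly R}).
Variable L : {scalar {poly R}}.
Hypothesis P_ok : monic_orthogonal w P H beta gamma.
Hypothesis L_cvg : forall p : {poly R},
  series (fun k : nat => p.[k%:R] * w k) @ \oo --> L p.

Lemma L_orth n m : L (P n * P m) = if n == m then H n else 0.
Proof.
have h := @mo_orth _ _ _ _ _ _ P_ok n m.
have h' := @L_cvg (P n * P m).
rewrite (_ : (fun k : nat => (P n * P m).[k%:R] * w k) =
  fun k : nat => (P n).[k%:R] * (P m).[k%:R] * w k) in h'.
  exact: cvg_unique h' h.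
by apply/funext => k; rewrite hornerM.
Qed.

Lemma normS n : H n.+1 = gamma n.+1 * H n.
Proof. by rewrite (mo_gammaS P_ok) divfK// (mo_norm_neq0 P_ok). Qed.

Lemma mulXP0 : 'X * P 0 = P 1 + beta 0 *: P 0.
Proof. by rewrite (mo_rec P_ok) scaler0 addr0. Qed.

Lemma mulXPS n :
  'X * P n.+1 = P n.+2 + beta n.+1 *: P n.+1 + gamma n.+1 *: P n.
Proof. by rewrite (mo_rec P_ok) /lag/= subn1. Qed.

Lemma jacobi_eq0 k l : (k.+1 < l)%N || (l.+1 < k)%N ->
  jacobi beta gamma k l = 0.
Proof.
rewrite /jacobi; have [->|_] := eqVneq l k; first by rewrite ltnNge leqnSn.
have [->|_] := eqVneq l k.+1; first by rewrite ltnn ltnNge leqW// leqnSn.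
by have [->|] := eqVneq k l.+1; first rewrite ltnn ltnNge leqW// leqnSn.
Qed.

(** This is row k of [J P(z) = z P(z)], the three-term recurrence in matrix form; the row stops at
    column k+1. *)
Lemma jacobi_mulP k : \sum_(l < k.+2) jacobi beta gamma k l *: P l = 'X * P k.
Proof.
rewrite !big_ord_recr/=; case: k => [|k].
  by rewrite big_ord0 /jacobi/= add0r mulXP0 scale1r addrC.
rewrite big_ord_recr big1/= => [|i _]; last first.
  by rewrite jacobi_eq0 ?scale0r// !ltnS ltn_ord orbT.
rewrite mulXPS /jacobi !eqxx (ltn_eqF (ltnSn _)) (ltn_eqF (ltnW (ltnSn _))).
rewrite (gtn_eqF (ltnSn _)).
by rewrite add0r scale1r [LHS]addrC [X in _ + X = _]addrC addrA.
Qed.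

(** In matrix form, [H J^T = J H]: multiplication by X is symmetric for [L]. Off the diagonal this
    is [H_{n+1} = gamma_{n+1} H_n]. *)
Lemma jacobi_normC i j :
  H i * jacobi beta gamma j i = jacobi beta gamma i j * H j.
Proof.
rewrite /jacobi; have [->|ij] := eqVneq i j; first by rewrite mulrC.
have [->|ij1] := eqVneq i j.+1.
  by rewrite ltn_eqF// mulr1 normS.
case: eqVneq => [->|_]; last by rewrite mulr0 mul0r.
by rewrite normS mul1r mulrC.
Qed.

(** Induction on d: [H J^T = J H] moves one factor [J] to the left of H, where [J P = X P] absorbs
    it as a factor X. By linearity, [H p(J^T)] is then the Gram matrix of the form with multiplier
    p. *)
Lemma norm_spow_jacobi d i j :
  H i * spow (str (jacobi beta gamma)) d i j = L ('X^d * P i * P j).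
Proof.
elim: d i => [|d IH] i.
  rewrite /spow/= /sone expr0 mul1r L_orth.
  by case: eqVneq => _; rewrite ?mulr1 ?mulr0.
rewrite /spow iterS -/(spow _ _) /smul (@fsbig_nat_ord _ _ i.+2); last first.
  move=> k ik; rewrite /str; have := jacobi_normC i k.
  rewrite (@jacobi_eq0 i k) ?ik// mul0r => /eqP; rewrite mulf_eq0.
  by rewrite (negPf (mo_norm_neq0 P_ok i))/= => /eqP->; rewrite mul0r.
rewrite exprSr -(mulrA _ 'X) -jacobi_mulP !mulr_sumr mulr_suml linear_sum.
apply: eq_bigr => k _.
rewrite -[str _ i k]/(jacobi beta gamma k i) mulrA jacobi_normC.
rewrite -(mulrA _ (H k)) IH.
by rewrite -scalarZ -scalerAr -scalerAl.
Qed.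

Lemma norm_spoly_jacobi (p : {poly R}) i j :
  H i * spoly p (str (jacobi beta gamma)) i j = L (p * P i * P j).
Proof.
rewrite /spoly mulr_sumr -[in RHS](coefK p) poly_def !big_distrl linear_sum/=.
apply: eq_bigr => d _; rewrite mulrCA norm_spow_jacobi -scalarZ.
by rewrite -!scalerAl.
Qed.

Lemma L_mulXP0 q : L ('X * P 0 * q) = L (P 1 * q) + beta 0 * L (P 0 * q).
Proof. by rewrite mulXP0 mulrDl -scalerAl linearD scalarZ. Qed.

Lemma L_mulXPS n q : L ('X * P n.+1 * q) =
  L (P n.+2 * q) + beta n.+1 * L (P n.+1 * q) + gamma n.+1 * L (P n * q).
Proof. by rewrite mulXPS !mulrDl -!scalerAl !linearD !scalarZ. Qed.

Lemma L_mulX0 n m : (n.+1 < m)%N -> L ('X * P n * P m) = 0.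
Proof.
case: n => [|n] nm; rewrite ?L_mulXP0 ?L_mulXPS !L_orth.
  by rewrite (ltn_eqF nm) (ltn_eqF (ltnW nm)) mulr0 addr0.
rewrite (ltn_eqF nm) (ltn_eqF (ltnW nm)) (ltn_eqF (ltnW (ltnW nm))).
by rewrite !mulr0 !addr0.
Qed.

Lemma L_mulX1 n : L ('X * P n * P n.+1) = H n.+1.
Proof.
case: n => [|n]; rewrite ?L_mulXP0 ?L_mulXPS !L_orth eqxx.
  by rewrite mulr0 addr0.
by rewrite !ltn_eqF// !mulr0 !addr0.
Qed.

Lemma L_mulX n : L ('X * P n * P n) = beta n * H n.
Proof.
case: n => [|n]; rewrite ?L_mulXP0 ?L_mulXPS !L_orth eqxx.
  by rewrite add0r.
by rewrite gtn_eqF// ltn_eqF// mulr0 addr0 add0r.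
Qed.

(** * Gram entries of a monic quadratic multiplier *)

Local Notation quad s t := ('X^2 + s *: 'X + t%:P).

(** Giving one factor X of [X^2] to each polynomial means that a single use of the recurrence on
    [P n] leaves only the known values of [L (X P_i P_j)]. *)
Lemma L_quadE s t n m : L (quad s t * P n * P m) =
  L ('X * P n * ('X * P m)) + s * L ('X * P n * P m) + t * L (P n * P m).
Proof.
rewrite -!scalarZ -!linearD; congr (L _).
rewrite !mulrDl -!scalerAl mul_polyC -scalerAl; congr (_ + _ + _).
by rewrite expr2 -!mulrA (mulrCA (P n)).
Qed.

Lemma L_mulPX n m : L (P n * ('X * P m)) = L ('X * P n * P m).
Proof. by rewrite mulrCA mulrA. Qed.

Lemma L_quad0 s t n m : (n.+2 < m)%N -> L (quad s t * P n * P m) = 0.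
Proof.
move=> nm; have nm1 := ltnW nm; have nm2 := ltnW nm1.
rewrite L_quadE L_mulX0// L_orth (ltn_eqF nm2) !mulr0 !addr0.
case: n nm nm1 nm2 => [|n] nm nm1 nm2.
  by rewrite L_mulXP0 !L_mulPX !L_mulX0// mulr0 addr0.
by rewrite L_mulXPS !L_mulPX !L_mulX0// !mulr0 !addr0.
Qed.

Lemma L_quad2 s t n : L (quad s t * P n * P n.+2) = H n.+2.
Proof.
rewrite L_quadE L_mulX0// L_orth ltn_eqF// !mulr0 !addr0.
case: n => [|n].
  by rewrite L_mulXP0 !L_mulPX L_mulX1 L_mulX0// mulr0 addr0.
by rewrite L_mulXPS !L_mulPX L_mulX1 !L_mulX0// !mulr0 !addr0.
Qed.

Lemma L_quad1 s t n :
  L (quad s t * P n * P n.+1) = (beta n + beta n.+1 + s) * H n.+1.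
Proof.
rewrite L_quadE L_mulX1 L_orth ltn_eqF// mulr0 addr0.
case: n => [|n].
  by rewrite L_mulXP0 !L_mulPX L_mulX L_mulX1; ring.
by rewrite L_mulXPS !L_mulPX L_mulX L_mulX1 L_mulX0//; ring.
Qed.

Lemma L_quad s t n : L (quad s t * P n * P n) =
  (gamma n + gamma n.+1 + beta n ^+ 2 + s * beta n + t) * H n.
Proof.
rewrite L_quadE L_mulX L_orth eqxx.
case: n => [|n].
  (* At n = 0 the recurrence has no [P_{-1}] term; the convention [gamma 0 = 0] makes the general
     formula hold here too. *)
  rewrite L_mulXP0 !L_mulPX L_mulX (mulrC 'X) -mulrA (mulrC (P 1)).
  by rewrite L_mulX1 normS (mo_gamma0 P_ok); ring.
rewrite L_mulXPS !L_mulPX L_mulX L_mulX1 mulrAC L_mulX1.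
by rewrite [H n.+2]normS (normS n); ring.
Qed.

(** * The two leading coefficients of the orthogonal polynomials *)

Lemma coef_lead n : (P n)`_n = 1.
Proof.
by have /monicP := mo_monic P_ok n; rewrite lead_coefE (mo_size P_ok).
Qed.

Lemma p1S n : p1 P n.+2 = p1 P n.+1 - beta n.+1.
Proof.
have := congr1 (fun p : {poly R} => p`_n.+1) (mulXPS n).
rewrite coefXM/= !coefD !coefZ coef_lead.
rewrite [(P n)`_ _]nth_default ?(mo_size P_ok)//.
by rewrite /p1 => ->; ring.
Qed.

(** * The dressed Pascal matrix and the structure matrix *)

Section Pascal.
Variables Pi Pinv : smx R.
Hypotheses (Pi_ok : dressed_pascal P Pi) (Pinv_ok : unitri_inverse Pi Pinv).

(** The Pascal matrix is defined by pointwise values; since R is infinite, these identities lift to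
    polynomials, where coefficients can be compared. *)
Lemma pascal_comp n : P n \Po ('X + 1) = \sum_(k < n.+1) Pi n k *: P k.
Proof.
have [lPi E] := Pi_ok.
have hE z : (P n \Po ('X + 1)).[z] = (\sum_(k < n.+1) Pi n k *: P k).[z].
  rewrite horner_comp hornerD hornerX hornerC horner_sum.
  have /(congr1 (@^~ n))/= -> := E z.
  by rewrite smulv_lower//; apply: eq_bigr => k _; rewrite hornerZ.
apply/eqP; rewrite -subr_eq0; apply/negPn/negP => d0.
set d := _ - _ in d0.
(* A nonzero difference d would vanish at the [size d] distinct points 0, 1, ..., which exceeds its
   degree. *)
pose s : seq R := [seq k%:R | k <- iota 0 (size d)].
have us : uniq s by rewrite map_inj_uniq ?iota_uniq//;
  exact: mulrIn (oner_neq0 R).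
have : (size s < size d)%N.
  apply: max_poly_roots => //; apply/allP => z _.
  by rewrite rootE /d hornerD hornerN hE subrr.
by rewrite size_map size_iota ltnn.
Qed.

Lemma pascal_sub1 n : Pi n.+1 n = n.+1%:R.
Proof.
have [lPi _] := Pi_ok.
have := congr1 (fun p : {poly R} => p`_n) (pascal_comp n.+1).
rewrite (@coef_comp_XaddC1 _ _ n.+2) ?(mo_size P_ok)// coef_sum.
rewrite !big_ord_recr/= !big1; first last.
- by move=> i _; rewrite bin_small// mulr0n.
- by move=> i _; rewrite coefZ nth_default ?mulr0// (mo_size P_ok).
rewrite !coefZ !coef_lead lPi.1 !add0r mulr1 mul1r binn mulr1n binSn addrC.
by move/addIr.
Qed.

(** Compare coefficients of z^n in [P_{n+2}(z+1)]. The unknown third coefficient of [P_{n+2}] occurs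
    on both sides and cancels, and [p1S] eliminates the second one in favour of that of
    [P_{n+1}]. *)
Lemma pascal_sub2 n :
  pi2 Pi n = n.+2%:R * n.+1%:R / 2 - n.+1%:R * beta n.+1 - p1 P n.+1.
Proof.
have [lPi _] := Pi_ok.
have := congr1 (fun p : {poly R} => p`_n) (pascal_comp n.+2).
rewrite (@coef_comp_XaddC1 _ _ n.+3) ?(mo_size P_ok)// coef_sum.
rewrite !big_ord_recr/= !big1; first last.
- by move=> i _; rewrite bin_small// mulr0n.
- by move=> i _; rewrite coefZ nth_default ?mulr0// (mo_size P_ok).
rewrite !coefZ !coef_lead lPi.1 pascal_sub1 binn binSn.
have b2 : ('C(n.+2, n)%:R : R) = n.+2%:R * n.+1%:R / 2.
  rewrite -(@bin_sub n.+2 n)//; last by rewrite -addn2 leq_addr.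
  have -> : (n.+2 - n = 2)%N by rewrite -addn2 addnC addnK.
  have := mul_bin_diag n.+2 1; rewrite bin1/= => e.
  by rewrite -natrM e natrM mulrC mulKf// pnatr_eq0.
rewrite b2 mulr1n -[X in _ + X + _]mulr_natr; have := p1S n.
rewrite /p1 => -> /eqP; rewrite -subr_eq0 => /eqP e.
by apply: subr0_eq; rewrite -[RHS]oppr0 -[X in _ = - X]e /pi2; ring.
Qed.

(** The inner sum is [P_n(z - 1)]. Stating this after the translation z -> z + 1 matches the form
    produced by the Pearson shift; it amounts to [Pinv Pi = 1]. *)
Lemma pascal_inv_comp n :
  (\sum_(k < n.+1) Pinv n k *: P k) \Po ('X + 1) = P n.
Proof.
have [lPi _] := Pi_ok; have [lPinv _ PinvPi] := Pinv_ok.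
rewrite linear_sum/=.
transitivity (\sum_(k < n.+1) \sum_(j < n.+1) (Pinv n k * Pi k j) *: P j).
  apply: eq_bigr => k _; rewrite linearZ/= pascal_comp scaler_sumr.
  (* The row of index k has only k+1 terms; padding it with the zeros of [Pi] above the diagonal
     gives a common range, so that the sums can be exchanged. *)
  rewrite (big_ord_widen _ (fun j => Pinv n k *: (Pi k j *: P j)) (ltn_ord k)).
  rewrite big_mkcond; apply: eq_bigr => j _; rewrite scalerA.
  by case: ltnP => // kj; rewrite lPi.2 ?mulr0 ?scale0r.
rewrite exchange_big/=; under eq_bigr => j _.
  rewrite -scaler_suml -(@smul_lower _ Pinv Pi n j)// PinvPi /sone.
  over.
rewrite big_ord_recr big1/= => [|j _]; last first.
  by rewrite gtn_eqF ?scale0r// ltn_ord.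
by rewrite eqxx scale1r add0r.
Qed.

Lemma laguerre_freud_theta theta n m :
  laguerre_freud theta Pinv H beta gamma n m =
  \sum_(k < n.+1) Pinv n k * L (theta * P k * P m).
Proof.
have [lPinv _ _] := Pinv_ok.
rewrite /laguerre_freud (smul_lower _ _ lPinv (ltnSn n)).
apply: eq_bigr => k _; rewrite -norm_spoly_jacobi; congr (_ * _).
rewrite /smul (@fsbig_nat_ord _ _ k.+1); last first.
  by move=> l kl; rewrite /sdiag ltn_eqF ?mul0r.
rewrite big_ord_recr big1/= => [|l _]; last first.
  by rewrite /sdiag gtn_eqF ?mul0r// ltn_ord.
by rewrite /sdiag eqxx add0r.
Qed.

(** Gathering the sum over [Pinv] inside [L] gives [L(theta(z) P_n(z-1) P_m(z))]. The shift turns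
    [P_n(z-1)] into [P_n] and [P_m] into [P_m(z+1)], which [Pi] expands. *)
Lemma laguerre_freud_sigma theta sigma n m :
  (forall q, L (theta * q) = L (sigma * (q \Po ('X + 1)))) ->
  laguerre_freud theta Pinv H beta gamma n m =
  \sum_(j < m.+1) Pi m j * L (sigma * P n * P j).
Proof.
move=> shift; rewrite laguerre_freud_theta.
transitivity (L (theta * ((\sum_(k < n.+1) Pinv n k *: P k) * P m))).
  rewrite mulr_suml mulr_sumr linear_sum; apply: eq_bigr => k _.
  by rewrite -scalarZ -mulrA -scalerAl -scalerAr.
rewrite shift comp_polyM pascal_inv_comp pascal_comp mulrA mulr_sumr linear_sum.
by apply: eq_bigr => j _; rewrite -scalarZ -scalerAr.
Qed.

End Pascal.

End Orthogonal.

(** * The Gauss hypergeometric weight *)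

Theorem theorem8 (R : realType) (a b c eta : R)
    (P : nat -> {poly R}) (H beta gamma : nat -> R) (Pi Pinv : smx R)
    (eta_neq0 : eta != 0) (eta_neqN1 : eta != -1)
    (c_ok : forall i : nat, c + 1 != - i%:R)
    (moments_ok : moments_abs_cvg (gauss_weight a b c eta))
    (hankel_ok : forall k : nat, (0 < k)%N ->
       \det (hankel (gauss_weight a b c eta) k) != 0)
    (P_ok : monic_orthogonal (gauss_weight a b c eta) P H beta gamma)
    (Pi_ok : dressed_pascal P Pi)
    (Pinv_ok : unitri_inverse Pi Pinv) :
  let Psi := laguerre_freud (gauss_theta c) Pinv H beta gamma in
  [/\ forall n : nat,
        p1 P n.+1 =
          n.+2%:R * beta n.+2 + beta n.+1
          + (eta - 1) / (eta + 1)
            * (gamma n.+3 + gamma n.+2 + beta n.+2 ^+ 2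
               + n.+2%:R * n.+1%:R / 2)
          + 1 / (eta + 1)
            * (eta * a * b + (eta * (a + b) - c) * beta n.+2
               + (eta * (a + b) + c) * n.+2%:R),
      forall n : nat,
        pi2 Pi n =
          1 / (1 + eta)
            * (n.+2%:R * n.+1%:R - eta * a * b
               - (eta * (a + b) - c) * beta n.+2
               - (eta * (a + b) + c) * n.+2%:R)
          + (1 - eta) / (1 + eta)
            * (gamma n.+3 + gamma n.+2 + beta n.+2 ^+ 2)
          - n.+2%:R * (beta n.+2 + beta n.+1)
    & [/\ forall n : nat, Psi n.+2 n = eta * H n.+2,
          forall n : nat,
            Psi n.+1 n
              = eta * (beta n + beta n.+1 + a + b + n%:R) * H n.+1,
          forall n : nat,
            Psi n n
              = eta * (gamma n + gamma n.+1 + (beta n + a) * (beta n + b)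
                       + n%:R * (lag 1 beta n + beta n + a + b)
                       + lag 2 (pi2 Pi) n) * H n,
          forall n : nat,
            Psi n n.+1 = (beta n + beta n.+1 + c - n%:R) * H n.+1
            /\ Psi n n.+2 = H n.+2
        & forall n m : nat, (n.+2 < m)%N || (m.+2 < n)%N -> Psi n m = 0]].
Proof.
move=> Psi; have [L L_cvg] := moment_functional moments_ok.
have [lPi _] := Pi_ok; have [lPinv _ _] := Pinv_ok.
have PiS := pascal_sub1 P_ok Pi_ok.
have PinvS n : Pinv n.+1 n = - n.+1%:R.
  by rewrite (unitri_inverse_sub1 _ lPi Pinv_ok) PiS.
have PinvSS n : Pinv n.+2 n = n.+2%:R * n.+1%:R - pi2 Pi n.
  by rewrite (unitri_inverse_sub2 _ lPi Pinv_ok) !PiS.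
have normS := normS P_ok.
(* [T] and [S] are the Gram matrices of theta and of sigma / eta, written as monic quadratics so
   that the same formulas serve both. They are symmetric and pentadiagonal. *)
pose T n m := L (('X^2 + c *: 'X + 0%:P) * P n * P m).
pose S n m := L (('X^2 + (a + b) *: 'X + (a * b)%:P) * P n * P m).
have TC n m : T n m = T m n by rewrite /T mulrAC.
have SC n m : S n m = S m n by rewrite /S mulrAC.
have T0 n m : (n.+2 < m)%N -> T n m = 0 by exact: (L_quad0 P_ok L_cvg).
have S0 n m : (n.+2 < m)%N -> S n m = 0 by exact: (L_quad0 P_ok L_cvg).
have T1 n : T n n.+1 = (beta n + beta n.+1 + c) * H n.+1
  by exact: (L_quad1 P_ok L_cvg).
have S1 n : S n n.+1 = (beta n + beta n.+1 + (a + b)) * H n.+1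
  by exact: (L_quad1 P_ok L_cvg).
have T2 n : T n n.+2 = H n.+2 by exact: (L_quad2 P_ok L_cvg).
have S2 n : S n n.+2 = H n.+2 by exact: (L_quad2 P_ok L_cvg).
have Tn n : T n n = (gamma n + gamma n.+1 + beta n ^+ 2 + c * beta n + 0) * H n.
  exact: (L_quad P_ok L_cvg).
have Sn n : S n n = (gamma n + gamma n.+1 + beta n ^+ 2 + (a + b) * beta n
    + a * b) * H n by exact: (L_quad P_ok L_cvg).
(* Here k <= n while [T k m] vanishes for k < m - 2, so at most three terms remain when m >= n. In
   [PsiS] below, j <= m gives the same for n >= m. *)
have PsiT n m : Psi n m = \sum_(k < n.+1) Pinv n k * T k m.
  rewrite /Psi (laguerre_freud_theta P_ok L_cvg Pinv_ok).
  by rewrite /T /gauss_theta mulrDr addr0 -expr2 -mul_polyC (mulrC 'X).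
have sigmaE : gauss_sigma a b eta =
    eta *: ('X^2 + (a + b) *: 'X + (a * b)%:P).
  rewrite /gauss_sigma -(mul_polyC (a + b)) polyCD polyCM.
  by congr (_ *: _); ring.
have PsiS n m : Psi n m = eta * \sum_(j < m.+1) Pi m j * S n j.
  rewrite /Psi (laguerre_freud_sigma P_ok L_cvg Pi_ok Pinv_ok _ _
    (sigma := gauss_sigma a b eta)) => [|q].
    rewrite sigmaE mulr_sumr; apply: eq_bigr => j _.
    by rewrite mulrCA; congr (_ * _); rewrite -scalarZ -!scalerAl.
  apply: pearson_shift L_cvg _ _ => [|k]; last exact: gauss_pearson.
  by rewrite /gauss_theta hornerM hornerX mul0r.
have Psi2 n : Psi n.+2 n = eta * H n.+2.
  rewrite PsiS big_ord_recr big1/= => [|j _]; last first.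
    by rewrite SC S0 ?mulr0// !ltnS ltn_ord.
  by rewrite add0r lPi.1 mul1r SC S2.
have Psi1 n : Psi n.+1 n = eta * (beta n + beta n.+1 + a + b + n%:R) * H n.+1.
  rewrite PsiS big_ord_recr/= lPi.1 mul1r SC S1; case: n => [|n].
    by rewrite big_ord0; ring.
  rewrite big_ord_recr big1/= => [|j _]; last first.
    by rewrite SC S0 ?mulr0// !ltnS ltn_ord.
  by rewrite PiS SC S2; ring.
have Psi0 n :
    Psi n n = eta * (gamma n + gamma n.+1 + (beta n + a) * (beta n + b)
     + n%:R * (lag 1 beta n + beta n + a + b) + lag 2 (pi2 Pi) n) * H n.
  (* The cases n = 0, n = 1 and n >= 2 are where one, two or three terms exist, in agreement with
     the zero values of [lag]. *)
  rewrite PsiS big_ord_recr/= lPi.1 mul1r Sn; case: n => [|n].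
    by rewrite big_ord0 /lag/=; ring.
  rewrite big_ord_recr/= PiS SC S1; case: n => [|n].
    by rewrite big_ord0 /lag/=; ring.
  rewrite big_ord_recr big1/= => [|j _]; last first.
    by rewrite SC S0 ?mulr0// !ltnS ltn_ord.
  by rewrite SC S2 /lag/= !subSS !subn0 /pi2; ring.
have Psi_1 n : Psi n n.+1 = (beta n + beta n.+1 + c - n%:R) * H n.+1.
  rewrite PsiT big_ord_recr/= lPinv.1 mul1r T1; case: n => [|n].
    by rewrite big_ord0; ring.
  rewrite big_ord_recr big1/= => [|j _]; last first.
    by rewrite T0 ?mulr0// !ltnS ltn_ord.
  by rewrite PinvS T2; ring.
have Psi_2 n : Psi n n.+2 = H n.+2.
  rewrite PsiT big_ord_recr big1/= => [|j _]; last first.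
    by rewrite T0 ?mulr0// !ltnS ltn_ord.
  by rewrite add0r lPinv.1 mul1r T2.
(* The diagonal computed from theta instead. At index n+2, [pi2 Pi n] enters through [Pinv n.+2 n],
   with sign opposite to that in [Psi0]. *)
have Psi0' n : Psi n.+2 n.+2 = (gamma n.+2 + gamma n.+3 + beta n.+2 ^+ 2
    + c * beta n.+2 - n.+2%:R * (beta n.+1 + beta n.+2 + c)
    + n.+2%:R * n.+1%:R - pi2 Pi n) * H n.+2.
  rewrite PsiT !big_ord_recr big1/= => [|j _]; last first.
    by rewrite T0 ?mulr0// !ltnS ltn_ord.
  by rewrite lPinv.1 PinvS PinvSS Tn T1 T2; ring.
have eta1 : 1 + eta != 0 by rewrite addrC addr_eq0.
(* After cancelling [H n.+2], the two diagonal values carry [eta * pi2] and [- pi2], whence the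
   factor 1 + eta. *)
have pi2_eq n : (1 + eta) * pi2 Pi n =
    (1 - eta) * (gamma n.+3 + gamma n.+2 + beta n.+2 ^+ 2)
    + (n.+2%:R * n.+1%:R - eta * a * b - (eta * (a + b) - c) * beta n.+2
       - (eta * (a + b) + c) * n.+2%:R)
    - (1 + eta) * (n.+2%:R * (beta n.+2 + beta n.+1)).
  have := Psi0' n; rewrite Psi0 => /(mulIf (mo_norm_neq0 P_ok _)).
  rewrite /lag/= !subSS !subn0 => /eqP; rewrite -subr_eq0 => /eqP e.
  (* The two sides of the goal differ by the same polynomial expression as the two sides of [e]. *)
  by apply: subr0_eq; rewrite -[RHS]e; ring.
have pi2F n : pi2 Pi n = 1 / (1 + eta)
      * (n.+2%:R * n.+1%:R - eta * a * b
         - (eta * (a + b) - c) * beta n.+2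
         - (eta * (a + b) + c) * n.+2%:R)
    + (1 - eta) / (1 + eta)
      * (gamma n.+3 + gamma n.+2 + beta n.+2 ^+ 2)
    - n.+2%:R * (beta n.+2 + beta n.+1).
  by apply: (mulfI eta1); rewrite pi2_eq; field.
split=> // [n|].
  (* The relation between [pi2] and [p1] is solved for [p1], and the value of [pi2] is then
     inserted. *)
  have -> : p1 P n.+1 = n.+2%:R * n.+1%:R / 2 - n.+1%:R * beta n.+1 - pi2 Pi n.
    by rewrite (pascal_sub2 P_ok Pi_ok); ring.
  by rewrite pi2F; field; rewrite addrC eta1.
(* Above the band all terms of the theta form vanish; below it, all terms of the sigma form. *)
split=> // n m /orP[nm|mn].
  rewrite PsiT big1// => k _; rewrite T0 ?mulr0//.
  by rewrite (leq_ltn_trans _ nm)// !ltnS -ltnS.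
rewrite PsiS big1 ?mulr0// => j _; rewrite SC S0 ?mulr0//.
by rewrite (leq_ltn_trans _ mn)// !ltnS -ltnS.
Qed.
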